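(* Let $X,Y$ be finite posets, for each $x\in X$ let $Y_x\subseteq Y$ be totally ordered, let $\Psi$ be a set of pairs $(x_1,x_2)$ in $X$ with $x_1<x_2$, and let $T$ be the set of tableaux $f:X\to Y$ with $f(x)\in Y_x$ for all $x$, $f(x_1)\le f(x_2)$ whenever $x_1\le x_2$, and $f(x_1)<f(x_2)$ whenever $(x_1,x_2)\in\Psi$. Set $E=\bigcup_{f\in T}f$ and $\Delta=\Delta(X,Y,T,E)$. For $f\in T$ and $x\in X$ let $U_f(x)$ be the set of $y\in Y$ with $f(x)<y$ such that changing the value of $f$ at $x$ from $f(x)$ to $y$ yields a tableau in $T$. Then \[K(S/I_\Delta;\mathbf t)=\sum_{f\in T}\prod_{x\in X}\Bigg(\big(1-t_{v_{(x,f(x))}}\big)\prod_{y\in U_f(x)}t_{v_{(x,y)}}\Bigg).\] Moreover, for each $j$, the entry $h_j$ of the $h$-vector of $S/I_\Delta$ equals the number of tableaux $f\in T$ with $\sum_{x\in X}|U_f(x)|=j$.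
   Context: A tableau is a function $f:X\to Y$ identified with its graph in $X\times Y$. Put $v_{(x,y)}:=E\setminus\{(x,y)\}$ for $(x,y)\in E$ and $V=\{v_{(x,y)}:(x,y)\in E\}$. The tableau complex $\Delta(X,Y,T,E)$ is the simplicial complex on ground set $V$ whose faces are the sets $\{v_{(x,y)}:(x,y)\in E\setminus F\}$ for $F\subseteq E$ containing some $f\in T$. Let $\mathbb{k}$ be a field, $S=\mathbb{k}[V]$, and $I_\Delta$ the Stanley–Reisner ideal, generated by $\prod_{v\in G}v$ for non-faces $G\subseteq V$. With the $\mathbb Z^V$-grading (variable $v$ of degree $t_v$), $K(S/I_\Delta;\mathbf t)$ is the numerator of the Hilbert series of $S/I_\Delta$ over $\prod_{v\in V}(1-t_v)$. The $h$-vector $(h_0,\dots,h_d)$ is defined by writing the $\mathbb Z$-graded Hilbert series (all $t_v\mapsto t$) as $\sum_j h_jt^j/(1-t)^d$, $d$ the Krull dimension of $S/I_\Delta$. *)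

(* Defs.v *)
From HB Require Import structures.
From mathcomp Require Import all_boot all_order all_algebra.
From mathcomp Require Export mpoly.

Set Implicit Arguments.
Unset Strict Implicit.
Unset Printing Implicit Defensive.

Import Order.TTheory GRing.Theory.

Local Open Scope ring_scope.

(* The polynomial ring R[V] over a ground set V : {set U} is {mpoly R[#|V|]},
   whose i-th variable stands for enum_val i \in V. The value 0 is a default
   for elements v outside V. *)
Definition pvar (R : nzRingType) (U : finType) (V : {set U}) (v : U) :
    {mpoly R[#|V|]} :=
  if [pick i : 'I_#|V| | enum_val i == v] is Some i then 'X_i else 0.

Section Ideals.
Variable S : comNzRingType.

(* Ideals are Prop-valued predicates: the ideals of ring_quotient are boolean,
   and moreover proper, which would exclude the unit ideal. *)
Definition is_ideal (P : S -> Prop) : Prop :=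
  [/\ P 0, forall a b, P a -> P b -> P (a + b) & forall a b, P b -> P (a * b)].

Definition is_prime_ideal (P : S -> Prop) : Prop :=
  [/\ is_ideal P, ~ P 1 & forall a b, P (a * b) -> P a \/ P b].

(* Primes of S / I are identified with the primes of S containing I. *)
Definition has_prime_chain (I : S -> Prop) (d : nat) : Prop :=
  exists P : 'I_d.+1 -> S -> Prop,
    [/\ forall i, is_prime_ideal (P i),
        forall i a, I a -> P i a &
        forall i j : 'I_d.+1, (i < j)%N ->
          (forall a, P i a -> P j a) /\ (exists a, P j a /\ ~ P i a)].

(* The Krull dimension of S / I is d; no d qualifies when S / I = 0. *)
Definition krull_dim_quot (I : S -> Prop) (d : nat) : Prop :=
  has_prime_chain I d /\ forall e, has_prime_chain I e -> (e <= d)%N.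

End Ideals.

(* dim_k (A / (A \cap I)) = n, for subspaces A and I of M: some n vectors of A
   form a basis of A modulo I. *)
Definition quot_dim (k : fieldType) (M : lmodType k) (A I : M -> Prop)
    (n : nat) : Prop :=
  exists b : 'I_n -> M,
    [/\ forall i, A (b i),
        forall p, A p ->
          exists c : 'I_n -> k, I (p - \sum_(i < n) c i *: b i) &
        forall c : 'I_n -> k,
          I (\sum_(i < n) c i *: b i) -> forall i, c i = 0].

Section Hilbert.
Variables (k : fieldType) (n : nat).

(* The component of degree g of k[x_1, ..., x_n] when monomials are graded by
   deg; deg := id gives the fine grading, deg := mdeg the standard one. *)
Definition graded_piece (G : eqType) (deg : 'X_{1..n} -> G) (g : G)
    (p : {mpoly k[n]}) : Prop :=
  forall m, m \in msupp p -> deg m = g.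

Definition hilbert_function (G : eqType) (deg : 'X_{1..n} -> G)
    (I : {mpoly k[n]} -> Prop) (H : G -> nat) : Prop :=
  forall g, quot_dim (graded_piece deg g) I (H g).

(* Coefficient of t^a in the product of D with the power series
   \sum_b H(b) t^b. *)
Definition coef_mul_series (D : {mpoly int[n]}) (H : 'X_{1..n} -> nat)
    (a : 'X_{1..n}) : int :=
  \sum_(b <- msupp D | (b <= a)%MM) D@_b * (H (a - b)%MM)%:Z.

(* K is the numerator of the finely graded Hilbert series of S / I over
   \prod_i (1 - t_i), i.e. their product as formal power series. *)
Definition is_K_polynomial (I : {mpoly k[n]} -> Prop) (K : {mpoly int[n]}) :
    Prop :=
  exists2 H : 'X_{1..n} -> nat,
    hilbert_function id I H &
    forall a, K@_a = coef_mul_series (\prod_(i < n) (1 - 'X_i)) H a.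

(* h = [:: h_0; ...; h_d] with \sum_j h_j t^j = (1 - t)^d * Hilb(S / I; t),
   d the Krull dimension. The zero ring (dimension -oo, Hilbert series 0) has
   the empty h-vector; the convention is h_j = 0 for j out of range. *)
Definition is_h_vector (I : {mpoly k[n]} -> Prop) (h : seq int) : Prop :=
  (I 1 /\ h = [::]) \/
  exists (d : nat) (H : nat -> nat),
    [/\ krull_dim_quot I d,
        hilbert_function (@mdeg n) I H,
        size h = d.+1 &
        forall j, h`_j =
          \sum_(i < j.+1) ((1 - 'X) ^+ d : {poly int})`_i * (H (j - i)%N)%:Z].

End Hilbert.

Definition SR_ideal (k : fieldType) (U : finType) (V : {set U})
    (D : {set {set U}}) (p : {mpoly k[#|V|]}) : Prop :=
  exists c : {set U} -> {mpoly k[#|V|]},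
    p = \sum_(G : {set U} | (G \subset V) && (G \notin D))
          c G * \prod_(v in G) pvar k V v.

Section Tableaux.
Variables X Y : finType.
Implicit Types (T : {set {ffun X -> Y}}) (E : {set X * Y}).

Definition graph (f : {ffun X -> Y}) : {set X * Y} := [set (x, f x) | x in X].

Definition tab_vertex E (e : X * Y) : {set X * Y} := E :\ e.

Definition tab_ground E : {set {set X * Y}} := [set tab_vertex E e | e in E].

Definition tableau_complex T E : {set {set {set X * Y}}} :=
  [set [set tab_vertex E e | e in E :\: F]
     | F in powerset E & [exists f in T, graph f \subset F]].

Definition tab_union T : {set X * Y} := \bigcup_(f in T) graph f.

Definition change (f : {ffun X -> Y}) (x : X) (y : Y) : {ffun X -> Y} :=
  [ffun x' => if x' == x then y else f x'].

End Tableaux.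

Definition poset_tableaux (dX dY : Order.disp_t) (X : finPOrderType dX)
    (Y : finPOrderType dY) (Y_ : X -> {set Y}) (Psi : {set X * X}) :
    {set {ffun X -> Y}} :=
  [set f : {ffun X -> Y} |
    [&& [forall x, f x \in Y_ x],
        [forall x1, forall x2, (x1 <= x2)%O ==> (f x1 <= f x2)%O] &
        [forall x1, forall x2, ((x1, x2) \in Psi) ==> (f x1 < f x2)%O]]].

Definition up_moves (X : finType) (dY : Order.disp_t) (Y : finPOrderType dY)
    (T : {set {ffun X -> Y}}) (f : {ffun X -> Y}) (x : X) : {set Y} :=
  [set y | (f x < y)%O && (change f x y \in T)].

(* Main.v *)
Require Import Defs.
From Stdlib Require Import Classical_Prop.
From HB Require Import structures.
From mathcomp Require Import all_boot all_order all_algebra.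
From mathcomp Require Import mpoly.

(** For a set [F] of pairs, the tableaux of [T] contained in [F] are closed
    under pointwise maximum, so they have a greatest element as soon as there is
    one; it is also the only one that cannot be raised inside [F] at a single
    [x] (raise at a maximal [x] where it differs from the greatest tableau).
    Hence the faces of the tableau complex are partitioned into the intervals
    from [U_f] to the facet [E :\: f], for [f] in [T]. The monomials whose
    variables form a set in such an interval have the generating series
    [prod_(U_f) t * prod_f (1 - t) / prod_V (1 - t)], which gives the
    K-polynomial; setting all variables to [t] and cancelling [(1 - t) ^ #|X|]
    gives the h-vector.

    The degree of the h-vector is normalised by the Krull dimension of a
    Stanley-Reisner ring, which is the largest size [d] of a face. Chains of
    ideals generated by variables give the lower bound. For the upper bound, a
    prime containing the ideal contains all the variables outside some face, so
    that the quotient by it contains at most [d] algebraically independent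
    elements, whereas for a chain of primes [P_0, ..., P_e] any choice of
    elements of [P_(i+1)] outside [P_i] is algebraically independent modulo
    [P_0]. *)

Import Order.TTheory GRing.Theory.

Local Open Scope ring_scope.

Set Implicit Arguments.
Unset Strict Implicit.
Unset Printing Implicit Defensive.

(** * Hilbert functions of monomial ideals *)

Section QuotientDimension.
Variables (k : fieldType) (M : lmodType k) (A I : M -> Prop).
Hypotheses (I0 : I 0) (ID : forall a b, I a -> I b -> I (a + b))
  (IZ : forall (c : k) a, I a -> I (c *: a)).

Lemma quot_dim_leq m n : quot_dim A I m -> quot_dim A I n -> (m <= n)%N.
Proof.
case=> b [Ab _ b_free] [b' [_ b'_gen _]].
have [C bC] : exists C : 'I_m -> 'I_n -> k,
    forall i, I (b i - \sum_(j < n) C i j *: b' j).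
  exact: fin_all_exists (fun i => b'_gen _ (Ab i)).
suff /eqP <- : row_free (\matrix_(i, j) C i j) by apply: rank_leq_col.
apply: inj_row_free => u uC0; apply/rowP => i; rewrite mxE.
apply: (b_free (fun i => u ord0 i)) => {i}.
suff -> : \sum_(i < m) u ord0 i *: b i =
    \sum_(i < m) u ord0 i *: (b i - \sum_(j < n) C i j *: b' j).
  by apply: big_ind => // i _; apply: IZ.
under [RHS]eq_bigr => i _ do rewrite scalerBr scaler_sumr.
rewrite sumrB exchange_big [X in _ = _ - X]big1 ?subr0 //= => j _.
under eq_bigr => i _ do rewrite scalerA.
rewrite -scaler_suml; have /rowP/(_ j) := uC0; rewrite !mxE.
by under eq_bigr => i _ do rewrite mxE; move=> ->; rewrite scale0r.
Qed.

Lemma quot_dim_uniq m n : quot_dim A I m -> quot_dim A I n -> m = n.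
Proof. by move=> dim_m dim_n; apply/eqP; rewrite eqn_leq !quot_dim_leq. Qed.

End QuotientDimension.

Definition standard_monomials (k : fieldType) n (I : {mpoly k[n]} -> Prop)
    (std : pred 'X_{1..n}) : Prop :=
  forall p, I p <-> {in msupp p, forall m, ~~ std m}.

Section MonomialIdeal.
Variables (k : fieldType) (n : nat) (I : {mpoly k[n]} -> Prop).
Variable std : pred 'X_{1..n}.
Hypothesis I_std : standard_monomials I std.

Section GradedPiece.
Variables (G : eqType) (deg : 'X_{1..n} -> G) (g : G) (s : seq 'X_{1..n}).
Hypotheses (s_uniq : uniq s)
  (mem_s : forall m, (m \in s) = (deg m == g) && std m).

Let mcoeff_comb (c : 'I_(size s) -> k) (m : 'X_{1..n}) :
  (\sum_(i < size s) c i *: 'X_[nth 0%MM s i])@_m =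
  \sum_(i < size s | nth 0%MM s i == m) c i.
Proof.
rewrite linear_sum /= [RHS]big_mkcond /=; apply: eq_bigr => i _.
by rewrite mcoeffZ mcoeffX; case: eqP; rewrite ?mulr1 ?mulr0.
Qed.

Let mcoeff_comb_nth (c : 'I_(size s) -> k) (i : 'I_(size s)) :
  (\sum_(j < size s) c j *: 'X_[nth 0%MM s j])@_(nth 0%MM s i) = c i.
Proof.
rewrite mcoeff_comb (eq_bigl (pred1 i)) ?big_pred1_eq // => j /=.
by rewrite nth_uniq ?ltn_ord.
Qed.

Let quot_dim_size : quot_dim (graded_piece deg g) I (size s).
Proof.
exists (fun i => 'X_[nth 0%MM s i]); split.
- move=> i m /mem_msuppXP <-; apply/eqP.
  by have := mem_nth 0%MM (ltn_ord i); rewrite mem_s => /andP[].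
- move=> p p_deg; exists (fun i => p@_(nth 0%MM s i)); apply/I_std => m.
  apply: contraL => std_m; rewrite -mcoeff_eq0 mcoeffB.
  have [/(nthP 0%MM)[i lt_is <-]|m_notin] := boolP (m \in s).
    pose i' := Ordinal lt_is.
    by rewrite (mcoeff_comb_nth (fun i => p@_(nth 0%MM s i)) i') subrr.
  rewrite mcoeff_comb big1 ?subr0 => [|i /eqP nth_m]; last first.
    by rewrite -nth_m mem_nth ?ltn_ord in m_notin.
  rewrite mcoeff_eq0; apply: contra m_notin => /p_deg deg_m.
  by rewrite mem_s deg_m eqxx.
- move=> c /I_std Ic i; apply/eqP.
  apply: contraTT (mem_nth 0%MM (ltn_ord i)) => ci_neq0.
  by rewrite mem_s negb_and (Ic _ _) ?orbT // mcoeff_msupp mcoeff_comb_nth.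
Qed.

Lemma quot_dim_graded_piece d :
  quot_dim (graded_piece deg g) I d <-> d = size s.
Proof.
split=> [dim_d|->]; last exact: quot_dim_size.
apply: quot_dim_uniq dim_d quot_dim_size.
- by apply/I_std => m; rewrite msupp0.
- move=> a b /I_std Ia /I_std Ib; apply/I_std => m /msuppD_le.
  by rewrite mem_cat => /orP[/Ia|/Ib].
- by move=> c a /I_std Ia; apply/I_std => m /msuppZ_le/Ia.
Qed.

End GradedPiece.

Lemma hilbert_function_fine H :
  hilbert_function id I H <-> H =1 fun m => nat_of_bool (std m).
Proof.
suff dimE m d : quot_dim (graded_piece id m) I d <-> d = std m.
  by split=> dimH m; apply/dimE.
rewrite (@quot_dim_graded_piece _ id m (nseq (std m) m)) ?size_nseq //.
  by case: (std m).
by move=> m'; rewrite mem_nseq lt0b andbC; case: eqP => //= ->.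
Qed.

Definition std_of_mdeg N j : {set 'X_{1..n < N}} :=
  [set m | (mdeg (val m) == j) && std (val m)].

Lemma quot_dim_mdeg N j d : (j < N)%N ->
  quot_dim (graded_piece (@mdeg n) j) I d <-> d = #|std_of_mdeg N j|.
Proof.
move=> lt_jN; rewrite cardE -(size_map val); apply: quot_dim_graded_piece.
  by rewrite map_inj_uniq ?enum_uniq //; apply: val_inj.
move=> m; apply/mapP/idP => [[b]|]; first by rewrite mem_enum inE => ? ->.
case/andP=> deg_m std_m; have lt_mN : (mdeg m < N)%N by rewrite (eqP deg_m).
by exists (BMultinom lt_mN); rewrite // mem_enum inE deg_m.
Qed.

Lemma hilbert_function_mdeg_exists : exists H, hilbert_function (@mdeg n) I H.
Proof.
exists (fun j => #|std_of_mdeg j.+1 j|) => j.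
exact/(quot_dim_mdeg _ (ltnSn j)).
Qed.

End MonomialIdeal.

Lemma horner_alg_wide (R : nzRingType) (A : algType R) (x : A) N
    (p : {poly R}) :
  (size p <= N)%N -> horner_alg x p = \sum_(j < N) p`_j *: x ^+ j.
Proof.
move=> le_pN; rewrite [LHS](@horner_coef_wide _ N).
  by apply: eq_bigr => j _; rewrite coef_map mulr_algl.
exact: leq_trans (size_poly _ _) le_pN.
Qed.

Section ProductsOfUnivariate.
Variables (R : comNzRingType) (n : nat).
Implicit Types (m a : 'X_{1..n}) (p : {mpoly R[n]}).

Definition mnm_of_ffun N (g : {ffun 'I_n -> 'I_N}) : 'X_{1..n} :=
  [multinom (g i : nat) | i < n].

Lemma mnm_of_ffun_inj N : injective (@mnm_of_ffun N).
Proof.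
move=> g g' /mnmP eq_gg'; apply/ffunP => i; apply: val_inj.
by have := eq_gg' i; rewrite !mnmE.
Qed.

Lemma mnm_of_ffun_onto N m :
  (forall i, m i < N)%N -> exists g : {ffun 'I_n -> 'I_N}, mnm_of_ffun g = m.
Proof.
move=> lt_mN; exists [ffun i => Ordinal (lt_mN i)].
by apply/mnmP => i; rewrite mnmE ffunE.
Qed.

Lemma mcoeff_prod_horner_alg (u : 'I_n -> {poly R}) a :
  (\prod_i horner_alg 'X_i (u i))@_a = \prod_i (u i)`_(a i).
Proof.
pose N := (\max_i maxn (size (u i)) (a i).+1)%N.
have /all_and2[le_size lt_a] i : (size (u i) <= N /\ a i < N)%N.
  by apply/andP; rewrite -geq_max; apply: (leq_bigmax (F := fun i => maxn _ _)).
under eq_bigr => i _ do rewrite (horner_alg_wide _ (le_size i)).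
rewrite bigA_distr_bigA linear_sum /=.
have [g0 g0E] := mnm_of_ffun_onto lt_a.
have termE (g : {ffun 'I_n -> 'I_N}) :
    (\prod_i ((u i)`_(g i) *: 'X_i ^+ g i) : {mpoly R[n]})@_a =
    (\prod_i (u i)`_(g i)) * (g == g0)%:R.
  rewrite scaler_prod mcoeffZ -[in LHS]g0E.
  rewrite (_ : \prod_i 'X_i ^+ g i = 'X_[mnm_of_ffun g]).
    by rewrite mcoeffX (inj_eq (@mnm_of_ffun_inj N)).
  by rewrite mpolyXE_id; apply: eq_bigr => i _; rewrite mnmE.
rewrite (bigD1 g0) //= [X in _ + X]big1 ?addr0 => [|g /negPf ne_g]; last first.
  by rewrite termE ne_g mulr0.
rewrite termE eqxx mulr1; apply: eq_bigr => i _.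
by rewrite -g0E mnmE.
Qed.

Lemma mcoeffXM m a p :
  ('X_[m] * p)@_a = if (m <= a)%MM then p@_(a - m) else 0.
Proof.
case: ifP => [le_ma|nle_ma];
  first by rewrite -{1}(submK le_ma) addmC mulrC mcoeffMX.
apply: memN_msupp_eq0; rewrite mulrC (perm_mem (msuppMX _ _)).
by apply/mapP => -[m' _ aE]; rewrite aE lem_addr in nle_ma.
Qed.

End ProductsOfUnivariate.

Section CoefMulSeries.
Variable n : nat.
Implicit Types (D q : {mpoly int[n]}) (H : 'X_{1..n} -> nat) (a : 'X_{1..n}).

Lemma coef_mul_seriesE D H a q :
  (forall b, (b <= a)%MM -> q@_b = (H b)%:Z) ->
  coef_mul_series D H a = (D * q)@_a.
Proof.
move=> qH; rewrite {2}[D]mpolyE mulr_suml linear_sum /= /coef_mul_series.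
rewrite big_mkcond; apply: eq_bigr => b _.
rewrite -scalerAl mcoeffZ mcoeffXM; case: ifP => _; last by rewrite mulr0.
by rewrite qH //; apply/mnm_lepP => i; rewrite mnmBE leq_subr.
Qed.

Lemma coef_mul_series_sum (F : finType) (P : pred F) D
    (H : F -> 'X_{1..n} -> nat) a :
  coef_mul_series D (fun m => \sum_(f | P f) H f m)%N a =
  \sum_(f | P f) coef_mul_series D (H f) a.
Proof.
rewrite exchange_big /=; apply: eq_bigr => b _.
by rewrite -mulr_sumr -(big_morph _ PoszD (erefl _)).
Qed.

Lemma eq_coef_mul_series D H H' a :
  H =1 H' -> coef_mul_series D H a = coef_mul_series D H' a.
Proof. by move=> eqH; apply: eq_bigr => b _; rewrite eqH. Qed.

Lemma coef_mul_series_prod (u : 'I_n -> {poly int}) (H : 'I_n -> nat -> nat) a :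
  coef_mul_series (\prod_i horner_alg 'X_i (u i))
    (fun m => \prod_i H i (m i))%N a =
  \prod_i (u i * \poly_(c < (a i).+1) (H i c)%:Z)`_(a i).
Proof.
pose q : {mpoly int[n]} :=
  \prod_i horner_alg 'X_i (\poly_(c < (a i).+1) (H i c)%:Z).
rewrite (@coef_mul_seriesE _ _ _ q) => [|b /mnm_lepP le_ba].
  rewrite -big_split -mcoeff_prod_horner_alg.
  by congr mcoeff; apply: eq_bigr => i _; rewrite rmorphM.
rewrite mcoeff_prod_horner_alg (big_morph _ PoszM (erefl _)).
by apply: eq_bigr => i _; rewrite coef_poly ltnS le_ba.
Qed.

End CoefMulSeries.

Lemma coef_1BX_exp_cancel (R : nzRingType) N r (q : {poly R}) :
  (forall i, (i < N)%N -> ((1 - 'X) ^+ r * q)`_i = 0) ->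
  forall i, (i < N)%N -> q`_i = 0.
Proof.
elim: r q => [|r IHr] q; first by rewrite expr0 mul1r.
rewrite exprSr -mulrA => /IHr {IHr} q0.
elim=> [|i IHi] lti; have := q0 _ lti;
  rewrite mulrBl mul1r coefB coefXM /= ?subr0 //.
by rewrite IHi ?subr0 // ltnW.
Qed.

Definition diag_spec n : {mpoly int[n]} -> {poly int} :=
  mmap (@polyC int) (fun=> 'X).

HB.instance Definition _ n := GRing.RMorphism.copy (@diag_spec n)
  (mmap (@polyC int) (fun=> 'X)).

Lemma diag_specX n (m : 'X_{1..n}) : diag_spec 'X_[m] = 'X^(mdeg m).
Proof. by rewrite [LHS]mmapX /mmap1 prodrXr -mdegE. Qed.

Lemma coef_diag_spec n (p : {mpoly int[n]}) j :
  (diag_spec p)`_j = \sum_(m <- msupp p | mdeg m == j) p@_m.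
Proof.
rewrite coef_sum [RHS]big_mkcond; apply: eq_bigr => m _.
rewrite mul_polyC coefZ /mmap1 prodrXr -mdegE coefXn eq_sym.
by case: eqP; rewrite ?mulr1 ?mulr0.
Qed.

Lemma eq_coef_diag_spec n (p q : {mpoly int[n]}) j :
  (forall m, mdeg m = j -> p@_m = q@_m) ->
  (diag_spec p)`_j = (diag_spec q)`_j.
Proof.
move=> eq_pq; apply/eqP; rewrite -subr_eq0 -coefB -rmorphB coef_diag_spec.
by rewrite big1 // => m /eqP/eq_pq eq_m; rewrite mcoeffB eq_m subrr.
Qed.

Section HilbertNumerators.
Variables (k : fieldType) (n : nat) (I : {mpoly k[n]} -> Prop).
Variable std : pred 'X_{1..n}.
Hypothesis I_std : standard_monomials I std.
Implicit Types K : {mpoly int[n]}.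

Lemma coef_diag_spec_K_polynomial K H N j : (j < N)%N ->
  is_K_polynomial I K -> hilbert_function (@mdeg n) I H ->
  (diag_spec K)`_j = ((1 - 'X) ^+ n * \poly_(i < N) (H i)%:Z)`_j.
Proof.
move=> lt_jN [Hf /(hilbert_function_fine I_std) HfE KE] hilbH.
pose q : {mpoly int[n]} := \sum_(m : 'X_{1..n < N}) (Hf m)%:Z *: 'X_[m].
have -> : (diag_spec K)`_j = (diag_spec (\prod_(i < n) (1 - 'X_i) * q))`_j.
  apply: eq_coef_diag_spec => m deg_m.
  rewrite KE (@coef_mul_seriesE _ _ _ _ q) //.
  move=> b le_bm; rewrite (mcoeff_mpoly (fun m => (Hf m)%:Z)) //.
  by rewrite (leq_ltn_trans _ lt_jN) // -deg_m -(submK le_bm) mdegD leq_addl.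
rewrite rmorphM rmorph_prod /= -[in RHS](card_ord n) -prodr_const.
have -> : \prod_(i < n) diag_spec (1 - 'X_i) = \prod_(i < n) (1 - 'X).
  by apply: eq_bigr => i _; rewrite rmorphB rmorph1 /= diag_specX mdeg1.
rewrite !coefM; apply: eq_bigr => i _; congr (_ * _).
have lt_iN : (j - i < N)%N by apply: leq_ltn_trans (leq_subr _ _) lt_jN.
rewrite coef_poly lt_iN (proj1 (quot_dim_mdeg I_std _ lt_iN) (hilbH _)).
rewrite raddf_sum coef_sum -sum1_card (big_morph _ PoszD (erefl _)) /=.
rewrite [RHS]big_mkcond; apply: eq_bigr => m _.
rewrite [diag_spec _]mmapZ mul_polyC coefZ [mmap _ _ _]diag_specX coefXn inE.
by rewrite HfE eq_sym; case: eqP; case: (std m).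
Qed.

Lemma h_vector_numerator K H d (q : {poly int}) : (d <= n)%N ->
  is_K_polynomial I K -> hilbert_function (@mdeg n) I H ->
  diag_spec K = (1 - 'X) ^+ (n - d) * q ->
  forall j, \sum_(i < j.+1) ((1 - 'X) ^+ d : {poly int})`_i * (H (j - i)%N)%:Z
    = q`_j.
Proof.
move=> le_dn KP hilbH specK j; pose Hj := \poly_(i < j.+1) (H i)%:Z.
have -> : \sum_(i < j.+1) ((1 - 'X) ^+ d : {poly int})`_i * (H (j - i)%N)%:Z =
    ((1 - 'X) ^+ d * Hj)`_j.
  by rewrite coefM; apply: eq_bigr => i _; rewrite coef_poly ltnS leq_subr.
apply/eqP; rewrite -subr_eq0 -coefB; apply/eqP.
apply: (@coef_1BX_exp_cancel _ j.+1 (n - d)) => // i lt_ij.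
rewrite mulrBr coefB -specK (coef_diag_spec_K_polynomial lt_ij KP hilbH).
by rewrite mulrA -exprD subnK ?subrr.
Qed.

End HilbertNumerators.

(** * Krull dimension *)

Lemma expn_leq_exponent d e C :
  (forall N, N ^ e <= (C * N).+1 ^ d)%N -> (e <= d)%N.
Proof.
move=> le_exp; rewrite leqNgt; apply/negP => lt_de.
pose N := (C.+1 ^ d).+1; have := le_exp N; rewrite leqNgt => /negP; apply.
apply: (@leq_ltn_trans ((C.+1 * N) ^ d)).
  have [-> //|d_gt0] := posnP d.
  by rewrite leq_exp2r // mulSn -add1n leq_add2r.
rewrite expnMn; apply: (@leq_trans (N ^ d.+1)); last by rewrite leq_pexp2l.
by rewrite expnS ltn_pmul2r // expn_gt0.
Qed.

Definition alg_independent_mod (R : comNzRingType) (S : comAlgType R)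
    (J : S -> Prop) e (a : 'I_e -> S) : Prop :=
  forall q : {mpoly R[e]}, J (mmap (in_alg S) a q) -> q = 0.

Section AlgebraicDependence.
Variables (k : fieldType) (n : nat).
Implicit Types p q : {mpoly k[n]}.

Definition mdeg_bounded d p := {in msupp p, forall m, mdeg m <= d}%N.

Lemma mdeg_bounded1 : mdeg_bounded 0 1.
Proof. by move=> m; rewrite -mpolyC1 msupp1 inE => /eqP ->; rewrite mdeg0. Qed.

Lemma mdeg_boundedM d e p q :
  mdeg_bounded d p -> mdeg_bounded e q -> mdeg_bounded (d + e) (p * q).
Proof.
move=> p_le q_le m /msuppM_le/allpairsP[[m1 m2] /= [/p_le ? /q_le ? ->]].
by rewrite mdegD leq_add.
Qed.

Lemma mdeg_boundedX d p j : mdeg_bounded d p -> mdeg_bounded (d * j) (p ^+ j).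
Proof.
move=> p_le; elim: j => [|j IHj]; first by rewrite muln0; apply: mdeg_bounded1.
by rewrite exprS mulnS; apply: mdeg_boundedM.
Qed.

Lemma mdeg_bounded_mmap1 D N e (a : 'I_e -> {mpoly k[n]})
    (g : {ffun 'I_e -> 'I_N}) :
  (forall i, mdeg_bounded D (a i)) ->
  mdeg_bounded (D * (e * N)) (mmap1 a (mnm_of_ffun g)).
Proof.
move=> aD m m_supp; apply: (@leq_trans (\sum_(i < e) D * g i)%N).
  apply: (big_ind2 mdeg_bounded) m m_supp; first exact: mdeg_bounded1.
    by move=> d p d' p'; apply: mdeg_boundedM.
  by move=> i _; rewrite mnmE; apply: mdeg_boundedX.
rewrite -big_distrr leq_mul2l /= -[X in (_ <= X * _)%N](card_ord e).
by rewrite -sum_nat_const leq_sum ?orbT // => i _; apply: ltnW.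
Qed.

(* The [N ^ e] monomials with exponents below [N] in [e] given polynomials have
   degree [O(N)], so they lie in a space of dimension [O(N ^ n)]. *)
Lemma alg_independent_leq_expn D N e (a : 'I_e -> {mpoly k[n]}) :
  (forall i, mdeg_bounded D (a i)) -> alg_independent_mod (eq^~ 0) a ->
  (N ^ e <= (D * (e * N)).+1 ^ n)%N.
Proof.
move=> aD a_free; set M := (D * (e * N))%N.
pose ev (g : {ffun 'I_e -> 'I_N}) := mmap1 a (mnm_of_ffun g).
pose A : 'M[k]_(#|{: {ffun 'I_e -> 'I_N}}|, #|{: {ffun 'I_n -> 'I_M.+1}}|) :=
  \matrix_(r, c) (ev (enum_val r))@_(mnm_of_ffun (enum_val c)).
suff /eqP : row_free A.
  by move=> rankA; have := rank_leq_col A; rewrite rankA !card_ffun !card_ord.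
apply: inj_row_free => u uA0.
pose q : {mpoly k[e]} :=
  \sum_r u ord0 r *: 'X_[mnm_of_ffun (enum_val r)].
have evq : mmap (in_alg _) a q = \sum_r u ord0 r *: ev (enum_val r).
  rewrite raddf_sum; apply: eq_bigr => r _.
  by rewrite /= mmapZ mmapX mulr_algl.
have q0 : q = 0.
  apply: a_free; rewrite evq; apply/mpolyP => m; rewrite mcoeff0 linear_sum /=.
  have [lt_Mm|le_mM] := ltnP M (mdeg m).
    rewrite big1 // => r _; rewrite mcoeffZ memN_msupp_eq0 ?mulr0 //.
    by apply: contraTN lt_Mm => /(mdeg_bounded_mmap1 aD); rewrite -leqNgt.
  have [|g <-] := @mnm_of_ffun_onto n M.+1 m.
    move=> i; rewrite ltnS (leq_trans _ le_mM) // mdegE (bigD1 i) //=.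
    exact: leq_addr.
  have /rowP/(_ (enum_rank g)) := uA0; rewrite !mxE => uAg.
  by rewrite -[RHS]uAg; apply: eq_bigr => r _; rewrite mcoeffZ mxE enum_rankK.
apply/rowP => r; rewrite mxE -[RHS](mcoeff0 k (mnm_of_ffun (enum_val r))) -q0.
rewrite linear_sum (bigD1 r) //= mcoeffZ mcoeffX eqxx mulr1 big1 ?addr0 //.
move=> r' ne_r; rewrite mcoeffZ mcoeffX (inj_eq (@mnm_of_ffun_inj _ _)).
by rewrite (inj_eq enum_val_inj) (negPf ne_r) mulr0.
Qed.

Lemma alg_independent_leq e (a : 'I_e -> {mpoly k[n]}) :
  alg_independent_mod (eq^~ 0) a -> (e <= n)%N.
Proof.
move=> a_free; pose D := (\max_(i < e) msize (a i))%N.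
apply: (@expn_leq_exponent _ _ (D * e)) => N; rewrite -mulnA.
apply: alg_independent_leq_expn a_free => i m /msize_mdeg_lt/ltnW le_m.
by apply: leq_trans le_m _; apply: leq_bigmax.
Qed.

End AlgebraicDependence.

Lemma mmap_muni (R : comNzRingType) (S : comAlgType R) e (a : 'I_e.+1 -> S)
    (q : {mpoly R[e.+1]}) :
  mmap (in_alg S) a q =
  (map_poly (mmap (in_alg S) (a \o widen_ord (leqnSn e))) (muni q)).[a ord_max].
Proof.
rewrite muniE raddf_sum horner_sum; apply: eq_bigr => m _ /=.
rewrite map_polyZ map_polyXn hornerZ hornerXn /= mmapZ mmapX -mulrA.
congr (_ * _); rewrite /mmap1 big_ord_recr; congr (_ * _).
by apply: eq_bigr => i _; rewrite mnmE.
Qed.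

Lemma muni_eq0 (R : comNzRingType) e (q : {mpoly R[e.+1]}) :
  muni q = 0 -> q = 0.
Proof.
move=> muni0; have := mmap_muni (fun i => 'X_i) q.
rewrite muni0 rmorph0 horner0 => <-; rewrite [LHS]mpolyE.
by apply: eq_bigr => m _; rewrite mulr_algl mmap1_id.
Qed.

Lemma lrmorph_mmap (R : comNzRingType) (S S' : comAlgType R)
    (f : {lrmorphism S -> S'}) e (a : 'I_e -> S) (q : {mpoly R[e]}) :
  f (mmap (in_alg S) a q) = mmap (in_alg S') (fun i => f (a i)) q.
Proof.
rewrite rmorph_sum; apply: eq_bigr => m _.
rewrite rmorphM /= rmorph_alg rmorph_prod; congr (_ * _).
by apply: eq_bigr => i _; rewrite rmorphXn.
Qed.

Lemma is_prime_ideal_ker (S : comNzRingType) (R : idomainType)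
    (f : {rmorphism S -> R}) : is_prime_ideal (fun x => f x = 0).
Proof.
split; first split.
- exact: rmorph0.
- by move=> a b fa0 fb0; rewrite rmorphD fa0 fb0 addr0.
- by move=> a b fb0; rewrite rmorphM fb0 mulr0.
- by rewrite rmorph1; apply/eqP/oner_neq0.
- move=> a b; rewrite rmorphM => /eqP; rewrite mulf_eq0.
  by case/orP=> /eqP; [left | right].
Qed.

Lemma is_idealZ (R : comNzRingType) (S : comAlgType R) (P : S -> Prop) c a :
  is_ideal P -> P a -> P (c *: a).
Proof. by case=> _ _ PM Pa; rewrite -mulr_algl; apply: PM. Qed.

Section Ideals.
Variables (S : comNzRingType) (P : S -> Prop).

Lemma is_ideal_sum (J : eqType) (r : seq J) (F : J -> S) :
  is_ideal P -> {in r, forall j, P (F j)} -> P (\sum_(j <- r) F j).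
Proof.
by case=> P0 PD _ PF; rewrite big_seq; apply: big_ind => // j /PF.
Qed.

Lemma prime_ideal_prod (J : finType) (A : {pred J}) (F : J -> S) :
  is_prime_ideal P -> P (\prod_(j in A) F j) -> exists2 j, j \in A & P (F j).
Proof.
case=> _ P1 Pprime Pprod; apply: NNPP => noP; move: Pprod.
apply: (big_ind (fun x => ~ P x)) => // [x y Px Py /Pprime[]//|j Aj PFj].
by apply: noP; exists j.
Qed.

End Ideals.

Section PrimeChains.
Variables (k : fieldType) (S : comAlgType k).

(* Peeling off the last variable [a_e]: a relation modulo [P_(e+1)], seen as a
   polynomial in [a_e], has its constant coefficient in [P_e], hence zero by
   induction; then divide by [a_e], which is not in the prime [P_(e+1)]. *)
Lemma descending_chain_alg_independent e (P : nat -> S -> Prop) (a : nat -> S) :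
  (forall i, (i <= e)%N -> is_prime_ideal (P i)) ->
  (forall i, (i < e)%N ->
     [/\ forall b, P i.+1 b -> P i b, P i (a i) & ~ P i.+1 (a i)]) ->
  alg_independent_mod (P e) (fun i : 'I_e => a i).
Proof.
elim: e => [|e IHe] Pprime Pchain q Pq.
  have [Pideal P1 _] := Pprime 0%N isT.
  have qE : q = (q@_0)%:MP.
    apply/mpolyP => m; rewrite mcoeffC (_ : m = 0%MM) ?eqxx ?mulr1 //.
    by apply/mnmP => -[].
  rewrite qE; have [-> //|q0_neq0] := eqVneq q@_0 0; case: P1.
  have := is_idealZ (q@_0)^-1 Pideal Pq.
  by rewrite qE mmapC scalerA mcoeffC eqxx mulr1 mulVf // scale1r.
have /IHe{}IHe i : (i <= e)%N -> is_prime_ideal (P i).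
  by move=> le_ie; apply: Pprime; apply: leqW.
have [P_sub Pe_ae Pe1_ae] := Pchain e (ltnSn e).
have [[_ PD PM] _ _] := Pprime e (leqnSn e).
have [_ _ Pe1prime] := Pprime e.+1 (leqnn _).
apply: muni_eq0; move: Pq; rewrite mmap_muni.
elim/poly_ind: (muni q) => // r c IHr.
rewrite rmorphD rmorphM /= map_polyX map_polyC !hornerE /= => Pr.
suff c0 : c = 0.
  rewrite c0 rmorph0 addr0 in Pr; rewrite c0 addr0.
  by case/Pe1prime: Pr => [/IHr ->|//]; rewrite mul0r.
apply: IHe => [i lt_ie|]; first by apply: Pchain; apply: leqW.
set ev := mmap _ _ c; set x := (X in P e.+1 (X + _)) in Pr.
rewrite -[ev](addKr x) -mulN1r.
by apply: PD (P_sub _ Pr); apply/PM/PM.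
Qed.

Lemma has_prime_chain_alg_independent (I : S -> Prop) e :
  has_prime_chain I e ->
  exists P, [/\ is_prime_ideal P, forall b, I b -> P b &
                exists a : 'I_e -> S, alg_independent_mod P a].
Proof.
case=> P [Pprime IP Pchain]; exists (P ord0).
split; [exact: Pprime | exact: IP |].
pose Q i := P (inord (e - i)).
have /fin_all_exists[b bQ] (i : 'I_e) : exists b, Q i b /\ ~ Q i.+1 b.
  case: (Pchain (inord (e - i.+1)) (inord (e - i))) => //.
  by rewrite !inordK ?ltnS ?leq_subr // ltn_sub2l.
pose a i := if insub i is Some j then b j else 0.
exists (fun i => a i); have -> : P ord0 = Q e.
  by rewrite /Q subnn; congr P; apply: val_inj; rewrite /= inordK.
apply: descending_chain_alg_independent => [i _|i lt_ie]; first exact: Pprime.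
rewrite /a insubT; have [Qb nQb] := bQ (Ordinal lt_ie); split=> //.
case: (Pchain (inord (e - i.+1)) (inord (e - i))) => //.
by rewrite !inordK ?ltnS ?leq_subr // ltn_sub2l.
Qed.

End PrimeChains.

Lemma krull_dim_quot_uniq (S : comNzRingType) (I : S -> Prop) d e :
  krull_dim_quot I d -> krull_dim_quot I e -> d = e.
Proof.
move=> [chain_d le_d] [chain_e le_e]; apply/eqP.
by rewrite eqn_leq le_d // le_e.
Qed.

Lemma krull_dim_quot_proper (S : comNzRingType) (I : S -> Prop) d :
  krull_dim_quot I d -> ~ I 1.
Proof.
case=> -[P [Pprime IP _]] _ /(IP ord0).
by case: (Pprime ord0).
Qed.

(** * Stanley-Reisner rings *)

Definition simplicial_complex (U : finType) (V : {set U}) (D : {set {set U}}) :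
    Prop :=
  {in D, forall G : {set U},
     G \subset V /\ forall G' : {set U}, G' \subset G -> G' \in D}.

Section Monomials.
Variables (U : finType) (V : {set U}).
Implicit Types (G : {set U}) (m : 'X_{1..#|V|}).

Definition vertices m : {set U} := [set enum_val i | i : 'I_#|V| & m i != 0%N].

Definition set_mnm G : 'X_{1..#|V|} :=
  [multinom nat_of_bool (enum_val i \in G) | i < #|V|].

Lemma ground_enum_val v : v \in V -> exists i : 'I_#|V|, v = enum_val i.
Proof. by move=> Vv; exists (enum_rank_in Vv v); rewrite enum_rankK_in. Qed.

Lemma mem_vertices m (i : 'I_#|V|) : (enum_val i \in vertices m) = (m i != 0%N).
Proof. by rewrite mem_imset ?inE //; apply: enum_val_inj. Qed.

Lemma vertices_subset m : vertices m \subset V.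
Proof. by apply/subsetP => v /imsetP[i _ ->]; apply: enum_valP. Qed.

Lemma verticesP m G :
  reflect (forall i : 'I_#|V|, m i != 0%N -> enum_val i \in G)
    (vertices m \subset G).
Proof.
apply: (iffP subsetP) => [sG i mi|sG v /imsetP[i + ->]].
  by apply: sG; rewrite mem_vertices.
by rewrite inE => /sG.
Qed.

Lemma subset_verticesP m G : G \subset V ->
  reflect (forall i : 'I_#|V|, enum_val i \in G -> m i != 0%N)
    (G \subset vertices m).
Proof.
move=> sGV; apply: (iffP subsetP) => [sG i /sG|sG v Gv].
  by rewrite mem_vertices.
have [i v_i] := ground_enum_val (subsetP sGV v Gv).
by rewrite v_i mem_vertices sG // -v_i.
Qed.

Lemma vertices_set_mnm G : G \subset V -> vertices (set_mnm G) = G.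
Proof.
move=> sGV; apply/eqP; rewrite eqEsubset; apply/andP; split.
  by apply/verticesP => i; rewrite mnmE eqb0 negbK.
by apply/(subset_verticesP _ sGV) => i; rewrite mnmE => ->.
Qed.

Lemma set_mnm_vertices_lep m : (set_mnm (vertices m) <= m)%MM.
Proof. by apply/mnm_lepP => i; rewrite mnmE mem_vertices; case: (m i). Qed.

Lemma verticesD m m' : vertices m \subset vertices (m' + m).
Proof.
apply/verticesP => i mi.
by rewrite mem_vertices mnmDE addn_eq0 negb_and mi orbT.
Qed.

Variable R : comNzRingType.

Lemma pvar_enum_val i : pvar R V (enum_val i) = 'X_i.
Proof.
rewrite /pvar; case: pickP => [j /eqP/enum_val_inj -> //|/(_ i)].
by rewrite eqxx.
Qed.

Lemma pvar_notin v : v \notin V -> pvar R V v = 0.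
Proof.
by rewrite /pvar; case: pickP => // i /eqP <-; rewrite enum_valP.
Qed.

Lemma prod_pvar G (F : {mpoly R[#|V|]} -> {mpoly R[#|V|]}) : G \subset V ->
  \prod_(v in G) F (pvar R V v) =
  \prod_(i < #|V|) if enum_val i \in G then F 'X_i else 1.
Proof.
move=> sGV; rewrite (eq_bigl (fun v => (v \in V) && (v \in G))) => [|v].
  rewrite big_enum_val_cond big_mkcond /=.
  by apply: eq_bigr => i _; rewrite pvar_enum_val.
by rewrite andb_idl //; apply: subsetP.
Qed.

Lemma mpolyX_set_mnm G : G \subset V ->
  'X_[set_mnm G] = \prod_(v in G) pvar R V v.
Proof.
move=> sGV; rewrite (prod_pvar id sGV) mpolyXE_id; apply: eq_bigr => i _.
by rewrite mnmE; case: ifP.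
Qed.

End Monomials.

Section FaceRing.
Variables (k : fieldType) (U : finType) (V : {set U}) (D : {set {set U}}).
Implicit Types (G : {set U}) (p : {mpoly k[#|V|]}).

Lemma SR_ideal_is_ideal : is_ideal (@SR_ideal k U V D).
Proof.
split=> [|p q [c ->] [d ->]|p q [c ->]].
- by exists (fun=> 0); rewrite big1 // => G _; rewrite mul0r.
- exists (fun G => c G + d G); rewrite -big_split /=.
  by apply: eq_bigr => G _; rewrite mulrDl.
- exists (fun G => p * c G); rewrite mulr_sumr.
  by apply: eq_bigr => G _; rewrite mulrA.
Qed.

Lemma SR_ideal_nonface G : G \subset V -> G \notin D ->
  SR_ideal D (\prod_(v in G) pvar k V v).
Proof.
move=> sGV GD; exists (fun G' => (G' == G)%:R).
rewrite (bigD1 G) ?sGV //= eqxx mul1r [X in _ + X]big1 ?addr0 //.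
by move=> G' /andP[_ /negPf ->]; rewrite mul0r.
Qed.

Hypothesis Dcomplex : simplicial_complex V D.

Lemma standard_monomials_SR_ideal :
  standard_monomials (@SR_ideal k U V D) (fun m => vertices m \in D).
Proof.
move=> p; split=> [[c ->] m|suppD].
  case/msupp_sum_le/flattenP=> s /mapP[G]; rewrite mem_filter.
  case/andP=> /andP[sGV GD] _ ->; rewrite -mpolyX_set_mnm //.
  case/msuppM_le/allpairsP=> -[m1 m2] /= [_ /mem_msuppXP <- ->].
  apply: contra GD => /Dcomplex[_]; apply.
  by rewrite -{1}(vertices_set_mnm sGV); apply: verticesD.
rewrite [p]mpolyE; apply: (is_ideal_sum SR_ideal_is_ideal) => m /suppD mD.
apply: is_idealZ SR_ideal_is_ideal _; case: SR_ideal_is_ideal => _ _.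
rewrite -(submK (set_mnm_vertices_lep m)) mpolyXD; apply.
rewrite mpolyX_set_mnm ?vertices_subset //.
by apply: SR_ideal_nonface; rewrite ?vertices_subset.
Qed.

Lemma SR_ideal1 : SR_ideal D (1 : {mpoly k[#|V|]}) <-> D = set0.
Proof.
have vertices0 : vertices (0%MM : 'X_{1..#|V|}) = set0.
  by apply/eqP; rewrite -subset0; apply/verticesP => i; rewrite mnm0E.
rewrite standard_monomials_SR_ideal -mpolyC1 msupp1.
split=> [D1|-> m _]; last by rewrite inE.
apply/setP => G; rewrite inE; apply: contraNF (D1 0%MM _); last by rewrite inE.
by rewrite vertices0 => /Dcomplex[_]; apply; apply: sub0set.
Qed.

End FaceRing.

Section FacePrime.
Variables (k : fieldType) (U : finType).
Implicit Types (V W G : {set U}).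

(* The variables outside [W] are set to 0, the default value of [pvar]. *)
Definition subst_vars V W : {mpoly k[#|V|]} -> {mpoly k[#|W|]} :=
  comp_mpoly [tuple pvar k W (enum_val i) | i < #|V|].

HB.instance Definition _ V W := GRing.LRMorphism.copy (@subst_vars V W)
  (comp_mpoly [tuple pvar k W (enum_val i) | i < #|V|]).

(* The prime ideal generated by the variables outside [G]. *)
Definition face_prime V G (p : {mpoly k[#|V|]}) : Prop := subst_vars G p = 0.

Lemma subst_vars_pvar V W v : v \in V ->
  subst_vars W (pvar k V v) = pvar k W v.
Proof.
case/ground_enum_val=> i ->; rewrite pvar_enum_val.
by rewrite /subst_vars comp_mpolyXU -tnth_nth tnth_mktuple.
Qed.

Lemma subst_varsX V W (m : 'X_{1..#|V|}) :
  subst_vars W 'X_[m] = \prod_i pvar k W (enum_val i) ^+ m i.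
Proof.
rewrite /subst_vars comp_mpolyX.
by apply: eq_bigr => i _; rewrite tnth_mktuple.
Qed.

Lemma subst_varsX_eq0 V W (m : 'X_{1..#|V|}) :
  ~~ (vertices m \subset W) -> subst_vars W 'X_[m] = 0.
Proof.
case/subsetPn=> v /imsetP[i + ->]; rewrite inE => mi Wv.
by rewrite subst_varsX (bigD1 i) //= pvar_notin // expr0n (negPf mi) mul0r.
Qed.

Lemma subst_varsXK V W (m : 'X_{1..#|V|}) : vertices m \subset W ->
  subst_vars V (subst_vars W 'X_[m]) = 'X_[m].
Proof.
move/verticesP=> sW; rewrite subst_varsX rmorph_prod mpolyXE_id.
apply: eq_bigr => i _; rewrite rmorphXn /=.
have [->|mi] := eqVneq (m i) 0%N; first by rewrite !expr0.
by rewrite subst_vars_pvar ?sW // pvar_enum_val.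
Qed.

Lemma subst_varsE V W (p : {mpoly k[#|V|]}) :
  subst_vars W p =
  \sum_(m <- msupp p | vertices m \subset W) p@_m *: subst_vars W 'X_[m].
Proof.
rewrite [LHS]comp_mpolyEX [RHS]big_mkcond; apply: eq_bigr => m _ /=.
case: ifP => // /negbT/subst_varsX_eq0 m0.
by rewrite -[_ \mPo _]/(subst_vars W _) m0 scaler0.
Qed.

Lemma subst_varsK V W (p : {mpoly k[#|V|]}) :
  subst_vars V (subst_vars W p) =
  \sum_(m <- msupp p | vertices m \subset W) p@_m *: 'X_[m].
Proof.
rewrite (subst_varsE W p) rmorph_sum; apply: eq_bigr => m /subst_varsXK mK /=.
by rewrite linearZ /= mK.
Qed.

Lemma face_primeP V G (p : {mpoly k[#|V|]}) :
  face_prime G p <-> {in msupp p, forall m, ~~ (vertices m \subset G)}.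
Proof.
split=> [p0 m m_supp|supp_p].
  apply/negP => sG; have := m_supp; rewrite mcoeff_msupp => /eqP; apply.
  have := congr1 (mcoeff m) (subst_varsK G p).
  rewrite p0 rmorph0 mcoeff0 linear_sum /= -big_filter => ->.
  rewrite (bigD1_seq m) ?mem_filter ?sG ?m_supp ?filter_uniq ?msupp_uniq //=.
  rewrite mcoeffZ mcoeffX eqxx mulr1 big1 ?addr0 // => m' /negPf ne_m.
  by rewrite mcoeffZ mcoeffX ne_m mulr0.
rewrite /face_prime subst_varsE big_seq_cond big1 // => m /andP[/supp_p].
by move=> /negPf ->.
Qed.

Lemma face_prime_is_prime V G : is_prime_ideal (@face_prime V G).
Proof. exact: is_prime_ideal_ker. Qed.

Lemma face_prime_pvar V G v :
  v \in V -> face_prime G (pvar k V v) <-> v \notin G.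
Proof.
move=> Vv; rewrite /face_prime subst_vars_pvar //.
split=> [pvar0|Gv]; last exact: pvar_notin.
apply/negP => /ground_enum_val[i v_i]; have /eqP := pvar0.
by rewrite v_i pvar_enum_val -msupp_eq0 msuppX.
Qed.

Lemma face_prime_anti V G G' (p : {mpoly k[#|V|]}) :
  G' \subset G -> face_prime G p -> face_prime G' p.
Proof.
move=> sG'G /face_primeP pG; apply/face_primeP => m /pG.
by apply: contra => /subset_trans; apply.
Qed.

Lemma face_prime_least V G (P : {mpoly k[#|V|]} -> Prop) : is_ideal P ->
  {in V :\: G, forall v, P (pvar k V v)} -> forall p, face_prime G p -> P p.
Proof.
move=> Pideal PG p /face_primeP pG; rewrite [p]mpolyE.
apply: (is_ideal_sum Pideal) => m /pG/subsetPn[v /imsetP[i + ->] Gv].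
rewrite inE -lep1mP => /submK <-; apply: (is_idealZ _ Pideal).
rewrite mpolyXD; case: Pideal => _ _; apply; rewrite -pvar_enum_val.
by apply: PG; rewrite inE Gv enum_valP.
Qed.

End FacePrime.

Lemma exists_finset_of_Prop (U : finType) (Q : U -> Prop) :
  exists G : {set U}, forall v, v \in G <-> Q v.
Proof.
suff /fin_all_exists[b bQ] (v : U) : exists b : bool, b <-> Q v.
  by exists [set v | b v] => v; rewrite inE.
by case: (classic (Q v)) => Qv; [exists true | exists false].
Qed.

Section KrullDimension.
Variables (k : fieldType) (U : finType) (V : {set U}) (D : {set {set U}}).
Implicit Types (G : {set U}) (p : {mpoly k[#|V|]}).
Implicit Types (P : {mpoly k[#|V|]} -> Prop).

Lemma has_prime_chain_face (I : {mpoly k[#|V|]} -> Prop) G :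
  G \subset V -> (forall p, I p -> face_prime G p) -> has_prime_chain I #|G|.
Proof.
move=> sGV IG; pose W (i : nat) := [set v in G | i <= index v (enum G)]%N.
have W_anti i j : (i <= j)%N -> W j \subset W i.
  move=> le_ij; apply/subsetP => v; rewrite !inE => /andP[-> le_j].
  exact: leq_trans le_j.
exists (fun i => @face_prime k U V (W i)); split=> [i|i p /IG|i j lt_ij].
- exact: face_prime_is_prime.
- by apply: face_prime_anti; apply/subsetP => v; rewrite inE => /andP[].
split=> [p|]; first by apply: face_prime_anti; apply/W_anti/ltnW.
have lt_iG : (i < #|G|)%N by rewrite (leq_trans lt_ij) // -ltnS.
pose v := enum_val (Ordinal lt_iG).
have [Gv vi] : v \in G /\ index v (enum G) = i.
  by rewrite enum_valP index_uniq ?enum_uniq // -cardE.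
exists (pvar k V v); rewrite !face_prime_pvar ?(subsetP sGV) // !inE vi Gv.
by rewrite leqnn -ltnNge.
Qed.

Lemma alg_independent_face_leq P G e (a : 'I_e -> {mpoly k[#|V|]}) :
  (forall p, face_prime G p -> P p) -> alg_independent_mod P a -> (e <= #|G|)%N.
Proof.
move=> sGP a_free.
apply: (@alg_independent_leq _ _ _ (fun i => subst_vars G (a i))) => q.
by rewrite -lrmorph_mmap => /sGP/a_free.
Qed.

Lemma prime_over_SR_ideal P : is_prime_ideal P ->
  (forall p, SR_ideal D p -> P p) ->
  exists2 G, G \in D & forall p, face_prime G p -> P p.
Proof.
move=> Pprime IP; have [Pideal _ _] := Pprime.
have [G GP] := exists_finset_of_Prop (fun v => v \in V /\ ~ P (pvar k V v)).
exists G.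
  apply/negPn/negP => GD; have sGV : G \subset V by apply/subsetP => v /GP[].
  have prodG := IP _ (SR_ideal_nonface k sGV GD).
  by have [v /GP[]] := prime_ideal_prod Pprime prodG.
apply: face_prime_least Pideal _ => v; rewrite inE => /andP[/negP Gv Vv].
by apply: NNPP => Pv; apply: Gv; apply/GP.
Qed.

Hypothesis Dcomplex : simplicial_complex V D.

Theorem krull_dim_SR_ideal :
  D != set0 -> krull_dim_quot (@SR_ideal k U V D) (\max_(G in D) #|G|).
Proof.
move=> /set0Pn[G0 G0D]; split=> [|e /has_prime_chain_alg_independent].
  have D_gt0 : (0 < #|D|)%N by apply/card_gt0P; exists G0.
  have [G GD ->] := eq_bigmax_cond (fun G : {set U} => #|G|) D_gt0.
  have [sGV _] := Dcomplex GD.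
  apply: has_prime_chain_face sGV _ => p.
  move=> /(standard_monomials_SR_ideal Dcomplex) pD.
  by apply/face_primeP => m /pD; apply: contra; case: (Dcomplex GD) => _; apply.
case=> P [Pprime IP [a a_free]].
have [G GD GP] := prime_over_SR_ideal Pprime IP.
exact: leq_trans (alg_independent_face_leq GP a_free) (leq_bigmax_cond _ GD).
Qed.

End KrullDimension.

(** * Interval partitions *)

Definition interval_partition (U F : finType) (D : {set {set U}}) (T : {set F})
    (lo hi : F -> {set U}) : Prop :=
  {in T, forall f, lo f \subset hi f} /\
  forall G : {set U},
    #|[set f in T | (lo f \subset G) && (G \subset hi f)]| = (G \in D) :> nat.

Lemma prodn_bool (J : finType) (b : pred J) :
  (\prod_j b j)%N = [forall j, b j] :> nat.
Proof.
have mulnbE : {morph nat_of_bool : x y / x && y >-> (x * y)%N}.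
  by move=> x y; rewrite mulnb.
by rewrite -(big_morph _ mulnbE (erefl : nat_of_bool true = 1%N)) big_andE.
Qed.

Section IntervalNumerator.
Variables (U : finType) (V : {set U}).
Implicit Types (lo hi : {set U}).

(* The numerator of the series of all monomials whose set of vertices lies
   between [lo] and [hi]. *)
Definition interval_numerator lo hi : {mpoly int[#|V|]} :=
  \prod_(v in V :\: hi) (1 - pvar int V v) * \prod_(v in lo) pvar int V v.

Let interval_factor lo hi (v : U) : {poly int} :=
  if v \in lo then 'X else if v \in hi then 1 else 1 - 'X.

Lemma interval_numeratorE lo hi : lo \subset hi -> hi \subset V ->
  interval_numerator lo hi =
  \prod_(i < #|V|) horner_alg 'X_i (interval_factor lo hi (enum_val i)).
Proof.
move=> le_lohi le_hiV; rewrite /interval_numerator.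
rewrite (prod_pvar (fun x => 1 - x)) ?subsetDl //.
rewrite (prod_pvar id) ?(subset_trans le_lohi) // -big_split.
apply: eq_bigr => i _; rewrite /interval_factor inE enum_valP andbT.
have [lo_i|lo_i] /= := boolP (enum_val i \in lo).
  by rewrite (subsetP le_lohi) // mul1r horner_algX.
have [_|_] := boolP (enum_val i \in hi); rewrite mulr1 ?rmorph1 //.
by rewrite rmorphB rmorph1 /= horner_algX.
Qed.

Lemma coef_mul_series_interval lo hi a : lo \subset hi -> hi \subset V ->
  coef_mul_series (\prod_(i < #|V|) (1 - 'X_i))
    (fun m => (lo \subset vertices m) && (vertices m \subset hi)) a =
  (interval_numerator lo hi)@_a.
Proof.
move=> le_lohi le_hiV; pose H (i : 'I_#|V|) c :=
  ((enum_val i \in lo) ==> (c != 0%N)) && ((c != 0%N) ==> (enum_val i \in hi)).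
have intervalE m :
    nat_of_bool ((lo \subset vertices m) && (vertices m \subset hi)) =
    (\prod_i H i (m i))%N.
  rewrite prodn_bool; congr nat_of_bool.
  apply/andP/forallP => [[/subset_verticesP lo_m /verticesP m_hi] i|lohi].
    apply/andP; split; apply/implyP; last exact: m_hi.
    by apply: lo_m; apply: subset_trans le_hiV.
  split; [apply/subset_verticesP | apply/verticesP] => [|i|i].
  - exact: subset_trans le_hiV.
  - by have /andP[/implyP] := lohi i.
  - by have /andP[_ /implyP] := lohi i.
rewrite (eq_coef_mul_series _ _ intervalE).
have -> : \prod_(i < #|V|) (1 - 'X_i) =
    \prod_(i < #|V|) horner_alg 'X_i (1 - 'X) :> {mpoly int[#|V|]}.
  by apply: eq_bigr => i _; rewrite rmorphB rmorph1 /= horner_algX.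
rewrite (coef_mul_series_prod _ (fun i c => nat_of_bool (H i c))).
rewrite interval_numeratorE // mcoeff_prod_horner_alg.
apply: eq_bigr => i _; rewrite mulrBl mul1r coefB coefXM !coef_poly /=.
rewrite /H /interval_factor; have := subsetP le_lohi (enum_val i).
case: (enum_val i \in lo) => [->|_] //; case: (enum_val i \in hi);
  case: (a i) => [|[|c]] //=;
  by rewrite ?coefB ?coefX ?coef1 ?ltnS ?leqnSn ?leqnn.
Qed.

Lemma diag_spec_interval_numerator lo hi : lo \subset hi -> hi \subset V ->
  diag_spec (interval_numerator lo hi) =
  (1 - 'X) ^+ (#|V| - #|hi|) * 'X^#|lo|.
Proof.
move=> le_lohi le_hiV; have le_loV := subset_trans le_lohi le_hiV.
have specX v : v \in V -> diag_spec (pvar int V v) = 'X.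
  by case/ground_enum_val=> i ->; rewrite pvar_enum_val diag_specX mdeg1.
rewrite rmorphM !rmorph_prod -cardsDS // -!prodr_const /=.
congr (_ * _); apply: eq_bigr => v.
  by rewrite inE => /andP[_ Vv]; rewrite rmorphB rmorph1 /= specX.
by move/(subsetP le_loV)/specX.
Qed.

End IntervalNumerator.

Section PartitionedComplex.
Variables (k : fieldType) (U F : finType) (V : {set U}) (D : {set {set U}}).
Variables (T : {set F}) (lo hi : F -> {set U}).
Hypothesis Dcomplex : simplicial_complex V D.
Hypothesis Dpart : interval_partition D T lo hi.

Let I := @SR_ideal k U V D.

Lemma interval_top_face : {in T, forall f, hi f \in D}.
Proof.
move=> f fT; have [le_lohi cardD] := Dpart.
rewrite -[_ \in D]lt0b -cardD; apply/card_gt0P; exists f.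
by rewrite inE fT le_lohi /=.
Qed.

Lemma interval_top_subset : {in T, forall f, hi f \subset V}.
Proof. by move=> f /interval_top_face/Dcomplex[]. Qed.

Lemma coef_mul_series_faces a :
  coef_mul_series (\prod_(i < #|V|) (1 - 'X_i)) (fun m => vertices m \in D) a =
  (\sum_(f in T) interval_numerator V (lo f) (hi f))@_a.
Proof.
have [le_lohi cardD] := Dpart.
have faceE (m : 'X_{1..#|V|}) : nat_of_bool (vertices m \in D) =
    (\sum_(f in T) ((lo f \subset vertices m) && (vertices m \subset hi f)))%N.
  rewrite -cardD -sum1_card big_mkcond [RHS]big_mkcond; apply: eq_bigr => f _.
  by rewrite inE; case: (f \in T) => //=; case: andP.
rewrite (eq_coef_mul_series _ _ faceE) coef_mul_series_sum linear_sum /=.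
apply: eq_bigr => f fT.
by apply: coef_mul_series_interval; rewrite ?le_lohi ?interval_top_subset.
Qed.

Let I_std : standard_monomials I (fun m => vertices m \in D).
Proof. exact: standard_monomials_SR_ideal. Qed.

Theorem is_K_polynomial_partition K :
  is_K_polynomial I K <-> K = \sum_(f in T) interval_numerator V (lo f) (hi f).
Proof.
split=> [[H /(hilbert_function_fine I_std) HE KE]|->].
  apply/mpolyP => a.
  by rewrite KE (eq_coef_mul_series _ _ HE) coef_mul_series_faces.
exists (fun m => nat_of_bool (vertices m \in D)).
  exact/(hilbert_function_fine I_std).
by move=> a; rewrite coef_mul_series_faces.
Qed.

Variable d : nat.
Hypothesis pure : {in T, forall f, #|hi f| = d}.

Lemma interval_partition_eq0 : (D == set0) = (T == set0).
Proof.
have [_ cardD] := Dpart; apply/eqP/eqP => [D0|T0].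
  apply/setP => f; rewrite inE; apply/negP => /interval_top_face.
  by rewrite D0 inE.
apply/setP => G; rewrite inE -[LHS]lt0b -cardD T0.
by rewrite eq_card0 // => f; rewrite !inE.
Qed.

Lemma krull_dim_partition : T != set0 -> krull_dim_quot I d.
Proof.
move=> T0; have D0 : D != set0 by rewrite interval_partition_eq0.
suff <- : (\max_(G in D) #|G| = d)%N by apply: krull_dim_SR_ideal.
have [_ cardD] := Dpart; have [f fT] := set0Pn _ T0.
apply/eqP; rewrite eqn_leq; apply/andP; split; last first.
  by rewrite -(pure fT); apply: leq_bigmax_cond (interval_top_face fT).
apply/bigmax_leqP => G; rewrite -[_ \in D]lt0b -cardD => /card_gt0P[g].
by rewrite inE => /and3P[gT _ /subset_leq_card]; rewrite pure.
Qed.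

Let krull_dim_leq : T != set0 -> (d <= #|V|)%N.
Proof.
case/set0Pn=> f fT; rewrite -(pure fT).
exact/subset_leq_card/interval_top_subset.
Qed.

Lemma hilbert_numerator_partition H j :
  T != set0 -> hilbert_function (@mdeg #|V|) I H ->
  \sum_(i < j.+1) ((1 - 'X) ^+ d : {poly int})`_i * (H (j - i)%N)%:Z =
  #|[set f in T | #|lo f| == j]|%:Z.
Proof.
move=> T0 hilbH; have [le_lohi _] := Dpart.
have KP : is_K_polynomial I (\sum_(f in T) interval_numerator V (lo f) (hi f)).
  exact/is_K_polynomial_partition.
rewrite (h_vector_numerator (q := \sum_(f in T) 'X^#|lo f|) I_std _ KP hilbH).
- rewrite coef_sum -sum1_card (big_morph _ PoszD (erefl _)).
  rewrite big_mkcond [RHS]big_mkcond; apply: eq_bigr => f _.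
  by rewrite inE coefXn eq_sym; case: (f \in T); case: eqP.
- exact: krull_dim_leq.
rewrite rmorph_sum mulr_sumr; apply: eq_bigr => f fT.
by rewrite /= diag_spec_interval_numerator ?le_lohi ?interval_top_subset ?pure.
Qed.

Theorem h_vector_partition h j :
  is_h_vector I h -> h`_j = #|[set f in T | #|lo f| == j]|%:Z.
Proof.
case=> [[/(SR_ideal1 k Dcomplex)/eqP D0 ->]|[e [H [dimI hilbH _ ->]]]].
  rewrite interval_partition_eq0 in D0; rewrite nth_nil eq_card0 // => f.
  by rewrite (eqP D0) !inE.
have T0 : T != set0.
  rewrite -interval_partition_eq0; apply/eqP => /(SR_ideal1 k Dcomplex).
  exact: krull_dim_quot_proper dimI.
rewrite (krull_dim_quot_uniq dimI (krull_dim_partition T0)).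
exact: hilbert_numerator_partition.
Qed.

Theorem h_vector_partition_exists : exists h, is_h_vector I h.
Proof.
have [T0|T0] := eqVneq T set0.
  exists [::]; left; split=> //; apply/(SR_ideal1 k Dcomplex)/eqP.
  by rewrite interval_partition_eq0 T0.
have [H hilbH] := hilbert_function_mdeg_exists I_std.
exists (mkseq (fun j => #|[set f in T | #|lo f| == j]|%:Z) d.+1); right.
exists d, H.
split=> [||| j]; [exact: krull_dim_partition|by []|exact: size_mkseq|].
rewrite hilbert_numerator_partition //; have [lt_jd|le_dj] := ltnP j d.+1.
  by rewrite nth_mkseq.
rewrite nth_default ?size_mkseq // eq_card0 // => f.
rewrite !inE; apply: contraTF le_dj => /andP[fT /eqP <-]; rewrite -ltnNge ltnS.
by rewrite -(pure fT) subset_leq_card //; case: Dpart => ->.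
Qed.

End PartitionedComplex.

(** * Tableau complexes *)

Section TableauComplex.
Variables (X Y : finType) (T : {set {ffun X -> Y}}) (E : {set X * Y}).
Implicit Types (f : {ffun X -> Y}) (A B : {set X * Y}).
Implicit Types (G : {set {set X * Y}}).

Lemma mem_graph f x y : ((x, y) \in graph f) = (y == f x).
Proof. by apply/imsetP/eqP => [[x' _ [-> ->]] // | ->]; exists x. Qed.

Lemma graph_subP f A : reflect (forall x, (x, f x) \in A) (graph f \subset A).
Proof.
apply: (iffP subsetP) => [sA x|fA [x y]]; first by rewrite sA ?mem_graph.
by rewrite mem_graph => /eqP ->.
Qed.

Lemma tab_vertex_inj : {in E &, injective (tab_vertex E)}.
Proof.
move=> e e' Ee Ee' /setP/(_ e); rewrite !inE Ee eqxx /= andbT.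
by move/esym/negbFE/eqP.
Qed.

Lemma imset_tab_vertex_subset A B : A \subset E -> B \subset E ->
  (tab_vertex E @: A \subset tab_vertex E @: B) = (A \subset B).
Proof.
move=> sAE sBE; apply/idP/idP => [/subsetP sAB|]; last exact: imsetS.
apply/subsetP => e Ae; have /imsetP[e' Be'] := sAB _ (imset_f _ Ae).
by move/(tab_vertex_inj (subsetP sAE _ Ae) (subsetP sBE _ Be')) => ->.
Qed.

Lemma subset_tab_groundP G :
  reflect (exists2 A : {set X * Y}, A \subset E & G = tab_vertex E @: A)
    (G \subset tab_ground E).
Proof.
apply: (iffP idP) => [/subsetP sG|[A sA ->]]; last exact: imsetS.
exists [set e in E | tab_vertex E e \in G].
  by apply/subsetP => e; rewrite inE => /andP[].
apply/setP => v; apply/idP/imsetP => [Gv|[e + ->]]; last first.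
  by rewrite inE => /andP[].
by have /imsetP[e Ee vE] := sG v Gv; exists e; rewrite // inE Ee -vE.
Qed.

Definition tab_facet f : {set {set X * Y}} := tab_vertex E @: (E :\: graph f).

Lemma tab_facet_subset f : tab_facet f \subset tab_ground E.
Proof. exact/imsetS/subsetDl. Qed.

Hypothesis graph_subE : {in T, forall f, graph f \subset E}.

Lemma imset_tab_vertex_facet f A : f \in T -> A \subset E ->
  (tab_vertex E @: A \subset tab_facet f) = (graph f \subset E :\: A).
Proof.
move=> fT sAE; rewrite imset_tab_vertex_subset ?subsetDl // !subsetD sAE.
by rewrite graph_subE // disjoint_sym.
Qed.

Lemma mem_tableau_complex G :
  (G \in tableau_complex T E) = [exists f in T, G \subset tab_facet f].
Proof.
apply/imsetP/exists_inP => [[F] | [f fT sG]].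
  rewrite inE => /andP[_ /exists_inP[f fT sfF]] ->; exists f => //.
  exact/imsetS/setDS.
have [A sAE GE] := subset_tab_groundP _ (subset_trans sG (tab_facet_subset f)).
exists (E :\: A); last by rewrite setDDr setDv set0U (setIidPr sAE).
rewrite inE powersetE subsetDl; apply/exists_inP; exists f => //.
by rewrite -imset_tab_vertex_facet // -GE.
Qed.

Lemma tableau_complex_simplicial :
  simplicial_complex (tab_ground E) (tableau_complex T E).
Proof.
move=> G; rewrite mem_tableau_complex => /exists_inP[f fT sG].
split=> [|G' sG'].
  exact: subset_trans sG (tab_facet_subset f).
rewrite mem_tableau_complex; apply/exists_inP; exists f => //.
exact: subset_trans sG.
Qed.

Lemma card_tab_facet f : f \in T -> #|tab_facet f| = (#|E| - #|X|)%N.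
Proof.
move=> fT; rewrite card_in_imset => [|e e']; last first.
  by rewrite !inE => /andP[_ Ee] /andP[_ Ee']; apply: tab_vertex_inj.
by rewrite cardsDS ?graph_subE // [#|graph f|]card_imset // => x x' [].
Qed.

Lemma tab_groundD_facet f : f \in T ->
  tab_ground E :\: tab_facet f = tab_vertex E @: graph f.
Proof.
move=> fT; have /subsetP sfE := graph_subE fT.
apply/setP => v; rewrite inE.
apply/andP/imsetP => [[nfv /imsetP[e Ee vE]]|[e fe ->]].
  exists e => //; apply: contraR nfv => nfe.
  by rewrite vE imset_f // inE nfe.
split; last exact/imset_f/sfE.
apply/imsetP => -[e']; rewrite inE => /andP[nfe' Ee'].
by move/(tab_vertex_inj (sfE _ fe) Ee') => eE; rewrite -eE fe in nfe'.
Qed.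

Lemma prod_imset_tab_vertex (R : comNzRingType) A (g : {set X * Y} -> R) :
  A \subset E ->
  \prod_(v in tab_vertex E @: A) g v = \prod_(e in A) g (tab_vertex E e).
Proof.
move=> /subsetP sAE; apply: big_imset => e e' /sAE Ee /sAE Ee'.
exact: tab_vertex_inj.
Qed.

End TableauComplex.

Lemma exists_maximal (A : finType) (r : rel A) (P : pred A) x0 :
  irreflexive r -> transitive r -> P x0 ->
  exists2 x, P x & forall z, r x z -> ~~ P z.
Proof.
move=> r_irr r_trans Px0; pose above x := [set z | r x z].
have [x Px min_x] := arg_minnP (fun x => #|above x|) Px0.
exists x => // z rxz; apply/negP => /min_x; rewrite leqNgt => /negP[].
apply: proper_card; apply/properP; split.
  by apply/subsetP => t; rewrite !inE; apply: r_trans.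
by exists z; rewrite !inE ?r_irr.
Qed.

Definition up_set (X : finType) (dY : Order.disp_t) (Y : finPOrderType dY)
    (T : {set {ffun X -> Y}}) (f : {ffun X -> Y}) : {set X * Y} :=
  [set e | e.2 \in up_moves T f e.1].

Definition locally_maximal (X : finType) (dY : Order.disp_t)
    (Y : finPOrderType dY) (T : {set {ffun X -> Y}}) (F : {set X * Y})
    (f : {ffun X -> Y}) : bool :=
  (graph f \subset F) && [disjoint up_set T f & F].

Section UpMoves.
Variables (X : finType) (dY : Order.disp_t) (Y : finPOrderType dY).
Variable T : {set {ffun X -> Y}}.
Implicit Types (f g : {ffun X -> Y}) (F : {set X * Y}).

Lemma mem_up_set f x y :
  ((x, y) \in up_set T f) = (f x < y)%O && (change f x y \in T).
Proof. by rewrite !in_set. Qed.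

Lemma card_up_set f : #|up_set T f| = (\sum_(x : X) #|up_moves T f x|)%N.
Proof.
rewrite -sum1_card.
under [RHS]eq_bigr => x _ do rewrite -sum1_card.
by rewrite pair_big_dep /=; apply: eq_bigl => e; rewrite inE.
Qed.

Lemma up_set_subset f : up_set T f \subset tab_union T.
Proof.
apply/subsetP => -[x y]; rewrite mem_up_set => /andP[_ fxyT].
by apply/bigcupP; exists (change f x y); rewrite // mem_graph ffunE eqxx.
Qed.

Lemma graph_subset_tab_union : {in T, forall f, graph f \subset tab_union T}.
Proof. by move=> f fT; apply: bigcup_sup. Qed.

Let E := tab_union T.
Let V := tab_ground E.
Let t x y := pvar int V (tab_vertex E (x, y)).

Lemma card_up_vertices f :
  #|tab_vertex E @: up_set T f| = (\sum_(x : X) #|up_moves T f x|)%N.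
Proof.
rewrite -card_up_set card_in_imset // => e e' up_e up_e'.
by apply: tab_vertex_inj; apply: (subsetP (up_set_subset f)).
Qed.

Lemma interval_numerator_tableau f : f \in T ->
  interval_numerator V (tab_vertex E @: up_set T f) (tab_facet E f) =
  \prod_(x : X) ((1 - t x (f x)) * \prod_(y in up_moves T f x) t x y).
Proof.
move=> fT; have sfE := graph_subset_tab_union fT.
rewrite /interval_numerator (tab_groundD_facet graph_subset_tab_union fT).
rewrite !prod_imset_tab_vertex ?up_set_subset // big_split /=; congr (_ * _).
  by rewrite big_imset //= => x x' _ _ [].
rewrite pair_big_dep /=; apply: eq_big => [e|[x y] _ //].
by rewrite inE.
Qed.

Definition pointwise_lt f g := (f != g) && [forall x, f x <= g x]%O.

Lemma pointwise_lt_irr : irreflexive pointwise_lt.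
Proof. by move=> f; rewrite /pointwise_lt eqxx. Qed.

Lemma pointwise_lt_trans : transitive pointwise_lt.
Proof.
move=> g f h /andP[ne_fg /forallP le_fg] /andP[_ /forallP le_gh].
apply/andP; split; last by apply/forallP => x; apply: le_trans (le_gh x).
apply: contra ne_fg => /eqP fh; apply/eqP/ffunP => x; apply/le_anti.
by rewrite le_fg fh le_gh.
Qed.

Lemma pointwise_lt_change f x y : (f x < y)%O -> pointwise_lt f (change f x y).
Proof.
move=> lt_fxy; apply/andP; split.
  apply/eqP => /ffunP/(_ x); rewrite ffunE eqxx => fxE.
  by rewrite -fxE ltxx in lt_fxy.
by apply/forallP => z; rewrite ffunE; case: eqP => // ->; apply: ltW.
Qed.

Lemma locally_maximal_exists F f : f \in T -> graph f \subset F ->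
  exists2 g, g \in T & locally_maximal T F g.
Proof.
move=> fT sfF; have Pf : (f \in T) && (graph f \subset F) by rewrite fT.
have [g /andP[gT sgF] max_g] :=
  exists_maximal (P := fun g => (g \in T) && (graph g \subset F))
    pointwise_lt_irr pointwise_lt_trans Pf.
exists g => //; rewrite /locally_maximal sgF disjoint_subset.
apply/subsetP => -[x y]; rewrite mem_up_set inE => /andP[lt_gxy gxyT].
have := max_g _ (pointwise_lt_change lt_gxy); rewrite gxyT /=.
apply: contra => Fxy; apply/graph_subP => z; rewrite ffunE.
by case: eqP => [-> //|_]; move/graph_subP: sgF.
Qed.

End UpMoves.

Section PosetTableaux.
Variables (dX dY : Order.disp_t) (X : finPOrderType dX) (Y : finPOrderType dY).
Variables (Y_ : X -> {set Y}) (Psi : {set X * X}).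
Hypothesis Y_total : forall x, {in Y_ x &, total (@Order.le dY Y)}.
Hypothesis Psi_lt : forall x1 x2, (x1, x2) \in Psi -> (x1 < x2)%O.

Local Notation T := (poset_tableaux Y_ Psi).
Implicit Types (f g : {ffun X -> Y}) (F : {set X * Y}).

Lemma poset_tableauxP f :
  reflect [/\ forall x, f x \in Y_ x,
              forall x1 x2, (x1 <= x2)%O -> (f x1 <= f x2)%O &
              forall x1 x2, (x1, x2) \in Psi -> (f x1 < f x2)%O] (f \in T).
Proof.
rewrite inE; apply: (iffP and3P) => -[fY f_le f_lt]; split.
- exact/forallP.
- by move=> x1 x2; move/forallP: f_le => /(_ x1)/forallP/(_ x2)/implyP.
- by move=> x1 x2; move/forallP: f_lt => /(_ x1)/forallP/(_ x2)/implyP.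
- exact/forallP.
- by apply/forallP => x1; apply/forallP => x2; apply/implyP; apply: f_le.
- by apply/forallP => x1; apply/forallP => x2; apply/implyP; apply: f_lt.
Qed.

Definition tab_max f g : {ffun X -> Y} := [ffun x => Order.max (f x) (g x)].

Lemma tab_maxP f g x : f \in T -> g \in T ->
  [/\ (f x <= tab_max f g x)%O, (g x <= tab_max f g x)%O &
      tab_max f g x = f x \/ tab_max f g x = g x].
Proof.
move=> /poset_tableauxP[fY _ _] /poset_tableauxP[gY _ _].
have /orP := Y_total (fY x) (gY x); rewrite ffunE maxEle.
by case: ifP => [le_fg _|_ [//|le_gf]]; split=> //; [right | left].
Qed.

Lemma tab_max_in f g : f \in T -> g \in T -> tab_max f g \in T.
Proof.
move=> fT gT; have maxP x := tab_maxP x fT gT.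
have /poset_tableauxP[fY f_le f_lt] := fT.
have /poset_tableauxP[gY g_le g_lt] := gT.
apply/poset_tableauxP; split=> [x|x1 x2 le12|x1 x2 Psi12].
- by case: (maxP x) => _ _ [] ->.
- have [le_f2 le_g2 _] := maxP x2.
  by case: (maxP x1) => _ _ [] ->;
    [apply: le_trans le_f2 | apply: le_trans le_g2]; auto.
- have [le_f2 le_g2 _] := maxP x2.
  by case: (maxP x1) => _ _ [] ->;
    [apply: lt_le_trans le_f2 | apply: lt_le_trans le_g2]; auto.
Qed.

Lemma graph_tab_max f g F : f \in T -> g \in T -> graph f \subset F ->
  graph g \subset F -> graph (tab_max f g) \subset F.
Proof.
move=> fT gT /graph_subP sfF /graph_subP sgF; apply/graph_subP => x.
by have [_ _ [] ->] := tab_maxP x fT gT.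
Qed.

Lemma change_in_poset_tableaux f g x : f \in T -> g \in T ->
  (forall z, f z <= g z)%O -> (forall z, (x < z)%O -> f z = g z) ->
  change f x (g x) \in T.
Proof.
move=> /poset_tableauxP[fY f_le f_lt] /poset_tableauxP[gY g_le g_lt].
move=> le_fg eq_fg.
apply/poset_tableauxP; split=> [z|x1 x2 le12|x1 x2 Psi12].
- by rewrite ffunE; case: eqP => [->|_].
- rewrite !ffunE.
  have [x1x|x1_neq] := eqVneq x1 x; have [x2x|x2_neq] := eqVneq x2 x => //.
  + by rewrite x1x in le12; rewrite eq_fg ?g_le // lt_neqAle eq_sym x2_neq.
  + by rewrite x2x in le12; apply: le_trans (f_le _ _ le12) (le_fg x).
  + exact: f_le.
- have lt12 := Psi_lt Psi12.
  rewrite !ffunE.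
  have [x1x|x1_neq] := eqVneq x1 x; have [x2x|x2_neq] := eqVneq x2 x.
  + by rewrite x1x x2x ltxx in lt12.
  + by rewrite x1x in Psi12 lt12; rewrite eq_fg ?g_lt.
  + by rewrite x2x in Psi12; apply: lt_le_trans (f_lt _ _ Psi12) (le_fg x).
  + exact: f_lt.
Qed.

(* At a maximal point where [f] and [g] differ, [f] can be raised to [g]. *)
Lemma locally_maximal_top F f g : f \in T -> locally_maximal T F f ->
  g \in T -> graph g \subset F -> (forall x, f x <= g x)%O -> f = g.
Proof.
move=> fT /andP[_ f_max] gT /graph_subP sgF le_fg.
apply/ffunP => x0; apply/eqP/negPn/negP => ne_x0.
have [x ne_x eq_above] :=
  exists_maximal (P := fun x => f x != g x) ltxx lt_trans ne_x0.
have /negP[] : (x, g x) \notin F.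
  rewrite (disjointFr f_max) // mem_up_set lt_neqAle ne_x le_fg /=.
  apply: change_in_poset_tableaux => // z /eq_above.
  by rewrite negbK => /eqP.
exact: sgF.
Qed.

Lemma locally_maximal_uniq F f g : f \in T -> locally_maximal T F f ->
  g \in T -> locally_maximal T F g -> f = g.
Proof.
move=> fT f_max gT g_max.
have [/andP[sfF _] /andP[sgF _]] := (f_max, g_max).
have maxT := tab_max_in fT gT; have maxF := graph_tab_max fT gT sfF sgF.
rewrite (locally_maximal_top fT f_max maxT maxF) => [|x]; last first.
  by case: (tab_maxP x fT gT).
rewrite -(locally_maximal_top gT g_max maxT maxF) // => x.
by case: (tab_maxP x fT gT).
Qed.

Lemma card_locally_maximal F :
  #|[set f in T | locally_maximal T F f]| =
  [exists f in T, graph f \subset F] :> nat.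
Proof.
case: exists_inP => [[f fT sfF]|noF].
  have [g gT g_max] := locally_maximal_exists fT sfF.
  rewrite (_ : [set _ in T | _] = [set g]) ?cards1 //; apply/setP => g'.
  rewrite in_set1 in_set; apply/andP/eqP => [[g'T g'_max]|->//].
  exact: locally_maximal_uniq g'_max gT g_max.
apply: eq_card0 => f; rewrite in_set; apply/negP => /andP[fT /andP[sfF _]].
by apply: noF; exists f.
Qed.

Let E := tab_union T.
Let V := tab_ground E.

Theorem poset_tableaux_partition :
  interval_partition (tableau_complex T E) T
    (fun f => tab_vertex E @: up_set T f) (tab_facet E).
Proof.
split=> [f fT|G].
  rewrite imset_tab_vertex_subset ?up_set_subset ?subsetDl //.
  rewrite subsetD up_set_subset disjoint_subset; apply/subsetP => -[x y].
  rewrite mem_up_set => /andP[lt_fxy _].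
  by rewrite inE mem_graph gt_eqF.
rewrite mem_tableau_complex; last exact: graph_subset_tab_union.
have [/subset_tab_groundP[A sAE ->]|nsG] := boolP (G \subset V); last first.
  have nfacet f : (G \subset tab_facet E f) = false.
    by apply: contraNF nsG => /subset_trans; apply; apply: tab_facet_subset.
  rewrite eq_card0 => [|f]; last by rewrite !inE nfacet !andbF.
  by case: exists_inP => // -[f _]; rewrite nfacet.
have facetE f : f \in T ->
    (tab_vertex E @: A \subset tab_facet E f) = (graph f \subset E :\: A).
  move=> fT; apply: imset_tab_vertex_facet fT sAE.
  exact: graph_subset_tab_union.
have -> : [exists f in T, tab_vertex E @: A \subset tab_facet E f] =
    [exists f in T, graph f \subset E :\: A].
  by apply: eq_existsb => f; have [/facetE ->|] := boolP (f \in T).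
rewrite -card_locally_maximal; apply: eq_card => f.
rewrite [LHS]in_set [RHS]in_set; have [fT|//] := boolP (f \in T).
rewrite /= facetE // imset_tab_vertex_subset ?up_set_subset // andbC.
congr (_ && _).
rewrite -{1}(setIidPr sAE) -[E :&: A]set0U -(setDv E) -setDDr subsetD.
by rewrite up_set_subset.
Qed.

End PosetTableaux.

Theorem theorem4p5 (k : fieldType) (dX dY : Order.disp_t)
    (X : finPOrderType dX) (Y : finPOrderType dY)
    (Y_ : X -> {set Y}) (Psi : {set X * X})
    (hY : forall x, {in Y_ x &, total (@Order.le dY Y)})
    (hPsi : forall x1 x2, (x1, x2) \in Psi -> (x1 < x2)%O) :
  let T := poset_tableaux Y_ Psi in
  let E := tab_union T in
  let V := tab_ground E in
  let I := @SR_ideal k _ V (tableau_complex T E) in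
  let t := fun (x : X) (y : Y) => pvar int V (tab_vertex E (x, y)) in
  (forall K : {mpoly int[#|V|]},
     is_K_polynomial I K <->
     K = \sum_(f in T) \prod_(x : X)
           ((1 - t x (f x)) * \prod_(y in up_moves T f x) t x y)) /\
  (exists h : seq int, is_h_vector I h) /\
  (forall h : seq int, is_h_vector I h -> forall j : nat,
     h`_j = #|[set f in T | (\sum_(x : X) #|up_moves T f x|)%N == j]|%:Z).
Proof.
move=> T E V I t.
have graphE : {in T, forall f, graph f \subset E}.
  exact: graph_subset_tab_union.
have complex := tableau_complex_simplicial graphE.
have partn := poset_tableaux_partition hY hPsi.
have pure : {in T, forall f, #|tab_facet E f| = #|E| - #|X|}%N.
  by move=> f; apply: card_tab_facet.
split; [|split].
- move=> K; rewrite (is_K_polynomial_partition k complex partn).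
  by under eq_bigr => f fT do rewrite (interval_numerator_tableau fT).
- exact: (h_vector_partition_exists k complex partn pure).
- move=> h hP j; rewrite (h_vector_partition complex partn pure j hP).
  by under eq_finset => f do rewrite card_up_vertices.
Qed.
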